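(* Let $\mathcal{I}$ be a meet-complete totally ordered set, and let $\mathbf{d}$ be a coarse $\mathcal{I}$-metric on a non-empty set $X$. For $R,S\in\mathcal{P}_0(X)$ set $$\check{\mathbf{d}}(R,S):=\inf\Big\{\alpha\in\mathcal{I}: R\subseteq\bigcup_{s\in S}\mathbf{D}(s,\alpha)\text{ and } S\subseteq\bigcup_{r\in R}\mathbf{D}(r,\alpha)\Big\}\in\mathcal{I}_\infty,$$ with the convention $\inf\emptyset=\infty$. (a) $\check{\mathbf{d}}$ is a coarse $\mathcal{I}$-metric on $\mathcal{P}_0(X)$. (b) The coarse structure on $\mathcal{P}_0(X)$ induced by $\check{\mathbf{d}}$ is precisely the Hausdorff coarse structure $\check{\mathcal{E}}_{\mathbf{d}}$ associated with the coarse structure $\mathcal{E}_{\mathbf{d}}$ induced by $\mathbf{d}$.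
   Context: For a set $X$, $\mathcal{P}_0(X)$ is the collection of non-empty subsets of $X$ and $\Delta_X=\{(x,x):x\in X\}$. For $A,B\subseteq X\times X$: $A^{-1}=\{(y,x):(x,y)\in A\}$, $A\circ B=\{(x,z):\exists y\in X,\ (x,y)\in A,\ (y,z)\in B\}$, and for $S\subseteq X$, $B[S]=\{y\in X:(x,y)\in B\text{ for some }x\in S\}$, $B[x]=B[\{x\}]$. A coarse structure on $X$ is a collection $\mathcal{E}\subseteq\mathcal{P}_0(X\times X)$ with $\Delta_X\in\mathcal{E}$ that is closed under the formation of (non-empty) subsets, inverses, products $\circ$ (whenever non-empty) and finite unions. A subcollection $\mathcal{B}\subseteq\mathcal{E}$ is a base for $\mathcal{E}$ if every element of $\mathcal{E}$ is contained in an element of $\mathcal{B}$. A partially ordered set $\mathcal{I}$ is meet-complete if every non-empty subset has a greatest lower bound in $\mathcal{I}$; its zero is its smallest element $0_{\mathcal{I}}$. $\mathcal{I}_\infty$ is $\mathcal{I}$ with a new element $\infty$ adjoined that is strictly larger than all elements of $\mathcal{I}$. For a map $\mathbf{d}:X\times X\to\mathcal{I}_\infty$ and $\alpha\in\mathcal{I}$ put $\mathbf{D}_\alpha=\{(x,y)\in X\times X:\mathbf{d}(x,y)\le\alpha\}$ and $\mathbf{D}(z,\alpha)=\mathbf{D}_\alpha[z]$ for $z\in X$. For $\mathcal{I}$ upward directed (any two elements have an upper bound) with a zero, $\mathbf{d}$ is a coarse $\mathcal{I}$-metric if $\mathbf{d}(x,x)=0_{\mathcal{I}}$ and $\mathbf{d}(x,y)=\mathbf{d}(y,x)$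 for all $x,y$, and there is a function $\Phi:\mathcal{I}\to\mathcal{I}$ with $\mathbf{D}_\alpha\circ\mathbf{D}_\alpha\subseteq\mathbf{D}_{\Phi(\alpha)}$ for all $\alpha\in\mathcal{I}$. The coarse structure $\mathcal{E}_{\mathbf{d}}$ induced by a coarse $\mathcal{I}$-metric $\mathbf{d}$ is the one having $\{\mathbf{D}_\alpha:\alpha\in\mathcal{I}\}$ as a base. Given a coarse structure $\mathcal{E}$ on $X$, let $\mathcal{I}^{\mathcal{E}}=\{E\in\mathcal{E}:E^{-1}=E,\ \Delta_X\subseteq E\}$ and, for $E\in\mathcal{I}^{\mathcal{E}}$, $\check E=\{(R,S)\in\mathcal{P}_0(X)\times\mathcal{P}_0(X):R\subseteq E[S]\text{ and }S\subseteq E[R]\}$. The Hausdorff coarse structure $\check{\mathcal{E}}$ associated with $\mathcal{E}$ is the coarse structure on $\mathcal{P}_0(X)$ generated by $\{\check E:E\in\mathcal{I}^{\mathcal{E}}\}$ (the smallest one containing it). *)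

(* Defs.v *)
From HB Require Import structures.
From mathcomp Require Import all_boot all_order.
From mathcomp Require Import boolp classical_sets.

Set Implicit Arguments.
Unset Strict Implicit.
Unset Printing Implicit Defensive.

Import Order.Theory.
Local Open Scope order_scope.
Local Open Scope classical_set_scope.

Definition P0 (X : Type) : set (set X) := [set A | A !=set0].
Arguments P0 X%_type : clear implicits.

(* The library's [B \; A] applies [A] first, whereas here [A] relates x to the
   intermediate point y and [B] relates y to z. *)
Definition rel_comp (X : Type) (A B : set (X * X)) : set (X * X) :=
  (B \; A)%relation.

Definition rel_image (X : Type) (B : set (X * X)) (S : set X) : set X :=
  [set y | exists2 x, S x & B (x, y)].

(* Closure under binary unions gives closure under non-empty finite unions; the
   empty union is the empty set, which is not in [P0]. *)
Record coarse_structure (X : Type) (E : set (set (X * X))) : Prop := {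
  coarse_P0 : E `<=` P0 (X * X);
  coarse_diagonal : E diagonal;
  coarse_subset : forall A B, E A -> B `<=` A -> B !=set0 -> E B;
  coarse_inverse : forall A, E A -> E (A^-1)%relation;
  coarse_comp : forall A B, E A -> E B ->
    rel_comp A B !=set0 -> E (rel_comp A B);
  coarse_union : forall A B, E A -> E B -> E (A `|` B)
}.

Definition is_base (X : Type) (E B : set (set (X * X))) : Prop :=
  B `<=` E /\ forall A, E A -> exists2 A', B A' & A `<=` A'.

Definition meet_complete (disp : Order.disp_t) (I : porderType disp) : Prop :=
  forall A : set I, A !=set0 -> infimums A !=set0.

Definition upward_directed (disp : Order.disp_t) (I : porderType disp) : Prop :=
  forall a b : I, exists c : I, a <= c /\ b <= c.

Definition is_zero (disp : Order.disp_t) (I : porderType disp) (z : I) : Prop :=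
  lbound [set: I] z.

(* I with a largest element adjoined: [None] is infinity. *)
Definition with_infty (disp : Order.disp_t) (I : porderType disp) : Type :=
  option I.

Section WithInfty.
Context (disp : Order.disp_t) (I : porderType disp).

HB.instance Definition _ := Choice.copy (with_infty I) (option I).

Definition fin (a : I) : with_infty I := Some a.
Definition infty : with_infty I := None.

Definition le_infty (u v : with_infty I) : bool :=
  match u, v with
  | _, None => true
  | None, Some _ => false
  | Some a, Some b => a <= b
  end.

Fact le_infty_refl : reflexive le_infty.
Proof. by case=> //= a. Qed.

Fact le_infty_anti : antisymmetric le_infty.
Proof. by case=> [a|] [b|] //= /le_anti ->. Qed.

Fact le_infty_trans : transitive le_infty.
Proof. by case=> [a|] [b|] [c|] //=; apply: le_trans. Qed.

HB.instance Definition _ := Order.Le_isPOrder.Build disp (with_infty I)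
  le_infty_refl le_infty_anti le_infty_trans.

End WithInfty.

Arguments infty {disp I}.

Section CoarseMetric.
Context (disp : Order.disp_t) (I : porderType disp) (X : Type).
Implicit Types (d : X -> X -> with_infty I) (E : set (set (X * X))).

Definition entourage d (alpha : I) : set (X * X) :=
  [set xy | d xy.1 xy.2 <= fin alpha].

Definition cball d (z : X) (alpha : I) : set X :=
  rel_image (entourage d alpha) [set z].

Record coarse_metric d : Prop := {
  coarse_metric_directed : upward_directed I;
  coarse_metric_zero :
    exists2 z : I, is_zero z & forall x, d x x = fin z;
  coarse_metric_sym : forall x y, d x y = d y x;
  coarse_metric_comp : exists Phi : I -> I, forall alpha,
    rel_comp (entourage d alpha) (entourage d alpha)
      `<=` entourage d (Phi alpha)
}.

(* Definite description: the coarse structure having the sets [entourage d _]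
   as a base. See [coarse_inducedP] below for existence and uniqueness when
   [d] is a coarse metric on a non-empty set. *)
Definition coarse_induced d : set (set (X * X)) :=
  xget set0 [set E | coarse_structure E /\ is_base E (range (entourage d))].

(* [infimum] returns its first argument on the empty set. *)
Definition hausdorff_dist d (R S : P0 X) : with_infty I :=
  infimum infty [set fin alpha | alpha in
    [set alpha | sval R `<=` \bigcup_(s in sval S) cball d s alpha /\
                 sval S `<=` \bigcup_(r in sval R) cball d r alpha]].

End CoarseMetric.

Section HausdorffCoarse.
Context (X : Type).
Implicit Types E : set (set (X * X)).

Definition sym_entourages E : set (set (X * X)) :=
  [set A | [/\ E A, (A^-1)%relation = A & diagonal `<=` A]].

Definition hausdorff_entourage (A : set (X * X)) : set (P0 X * P0 X) :=
  [set RS | sval RS.1 `<=` rel_image A (sval RS.2) /\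
            sval RS.2 `<=` rel_image A (sval RS.1)].

Definition hausdorff_coarse E : set (set (P0 X * P0 X)) :=
  smallest (@coarse_structure (P0 X)) (hausdorff_entourage @` sym_entourages E).

End HausdorffCoarse.

Lemma coarse_inducedP (disp : Order.disp_t) (I : porderType disp) (X : Type)
    (d : X -> X -> with_infty I) : [set: X] !=set0 -> coarse_metric d ->
  forall E, coarse_structure E /\ is_base E (range (entourage d)) <->
            E = coarse_induced d.
Proof.
move=> [x0 _] [dir [z z0 dz] dC [Phi dPhi]] E.
have mono a b : a <= b -> entourage d a `<=` entourage d b.
  by move=> ab xy /= /le_trans; apply.
have diag a : diagonal `<=` entourage d a.
  by move=> [x y] xy; rewrite /entourage /= -[y]xy dz; exact: z0.
pose F : set (set (X * X)) :=
  [set A | A !=set0 /\ exists a, A `<=` entourage d a].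
have FP : coarse_structure F /\ is_base F (range (entourage d)).
  split; first split.
  - by move=> A [].
  - by split; [exists (x0, x0)|exists z].
  - by move=> A B [_ [a Aa]] BA B0; split=> //; exists a; exact: subset_trans Aa.
  - move=> A [[[x y] Axy] [a Aa]]; split; first by exists (y, x).
    by exists a => -[u v] /= /Aa; rewrite /entourage /= dC.
  - move=> A B [_ [a Aa]] [_ [b Bb]] AB0; split=> //.
    have [c [ac bc]] := dir a b; exists (Phi c).
    apply: subset_trans (dPhi c) => -[u v] [w Auw Bwv].
    by exists w => /=; [exact/(mono a)/Aa|exact/(mono b)/Bb].
  - move=> A B [[xy Axy] [a Aa]] [_ [b Bb]]; split; first by exists xy; left.
    have [c [ac bc]] := dir a b; exists c.
    by move=> u [/Aa|/Bb]; exact: mono.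
  split=> [_ [a _ <-]|A [_ [a Aa]]]; last by exists (entourage d a) => //; exists a.
  by split; [exists (x0, x0); exact: diag|exists a].
have uniqF G : coarse_structure G /\ is_base G (range (entourage d)) -> G = F.
  move=> [Gc [DG Gb]]; apply/seteqP; split=> A.
    move=> GA; split; first exact: (coarse_P0 Gc).
    by have [_ [a _ <-] Aa] := Gb A GA; exists a.
  move=> [A0 [a Aa]]; apply: (coarse_subset Gc _ Aa A0).
  by apply: DG; exists a.
suff -> : coarse_induced d = F by split=> [/uniqF|->].
apply: uniqF.
exact: (@xgetI _ set0
  [set G | coarse_structure G /\ is_base G (range (entourage d))] F FP).
Qed.

(* Main.v *)
Require Import Defs.
From mathcomp Require Import all_boot all_order.
From mathcomp Require Import boolp classical_sets.

Set Implicit Arguments.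
Unset Strict Implicit.
Unset Printing Implicit Defensive.

Local Open Scope classical_set_scope.

(** Write [D_a] for [entourage d a] and [H_a] for
    [hausdorff_entourage (D_a)].  The set whose infimum is
    [hausdorff_dist d R S] is the set of all [a] with [(R, S)] in [H_a], and it is closed upwards
    because [D_a] grows with [a].  Hence [H_a] is contained in the entourage of
    [hausdorff_dist d] at level [a].  The converse inclusion can fail, since the
    infimum need not be attained, but it holds up to a change of level: in a
    total order, [hausdorff_dist d R S <= a < b] forces [(R, S)] into [H_b].  If no
    [b] exceeds [a], then [a] is the maximum of the index set, and a finite
    distance means that [(R, S)] lies in some [H_c], hence in [H_a].  So for
    every [a] there is a [b], independent of [R] and [S], such that the
    entourage at level [a] is contained in [H_b]
    ([entourage_hausdorff_dist_sub]).

    The sets [H_a] and the entourages of [hausdorff_dist d] being thus cofinal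
    in each other, both claims reduce to the same claims for the [H_a].  The
    composition [H_b] with [H_b] lies in the Hausdorff entourage of [D_b]
    composed with [D_b], which gives the triangle condition.  The [H_a] generate
    the Hausdorff coarse structure because every symmetric reflexive entourage
    lies in some [D_a], and the [D_a] are themselves symmetric and reflexive. *)

(** * Infima in an order with infinity adjoined *)

(** The default value infinity makes this hold for empty [A] too: infinity is
    the greatest lower bound of the empty set. *)
Lemma infimumsP_fin (disp : Order.disp_t) (I : porderType disp) (A : set I) :
  meet_complete I ->
  infimums (@fin _ I @` A) (infimum infty (@fin disp I @` A)).
Proof.
move=> mI; rewrite /infimum; case: ifPn => [/eqP ->|].
  by split=> // -[].
case/set0P=> _ [a Aa _].
have [m [mA m_max]] : infimums A !=set0 by apply: mI; exists a.
apply: (@xgetI _ _ _ (fin m)); split=> [_ [b Ab <-]|]; first exact: mA.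
case=> [u|] uA; last by apply: (uA (fin a)); exists a.
by apply: m_max => b Ab; apply: (uA (fin b)); exists b.
Qed.

(** * Entourages *)

Section Entourages.
Variables (disp : Order.disp_t) (I : porderType disp) (X : Type).
Implicit Type d : X -> X -> with_infty I.

Lemma entourage_le d (a b : I) :
  (a <= b)%O -> entourage d a `<=` entourage d b.
Proof. by move=> ab xy /= /Order.POrderTheory.le_trans; apply. Qed.

Lemma entourage_diagonal d (a : I) :
  coarse_metric d -> diagonal `<=` entourage d a.
Proof.
by move=> [_ [z z0 dz] _ _] [x y] xy; rewrite /entourage /= -[y]xy dz; apply: z0.
Qed.

Lemma entourage_inverse d (a : I) :
  coarse_metric d -> (entourage d a)^-1%relation = entourage d a.
Proof.
by move=> [_ _ dC _]; apply/seteqP; split=> -[x y]; rewrite /entourage /= dC.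
Qed.

Lemma entourage_in_induced d (a : I) : [set: X] !=set0 -> coarse_metric d ->
  coarse_induced d (entourage d a).
Proof.
move=> X0 dm; have [_ [DE _]] := (coarse_inducedP X0 dm _).2 erefl.
by apply: DE; exists a.
Qed.

Lemma induced_sub_entourage d A : [set: X] !=set0 -> coarse_metric d ->
  coarse_induced d A -> exists a, A `<=` entourage d a.
Proof.
move=> X0 dm dA; have [_ [_ /(_ A dA)]] := (coarse_inducedP X0 dm _).2 erefl.
by move=> [_ [a _ <-] Aa]; exists a.
Qed.

End Entourages.

Section HausdorffEntourages.
Variable X : Type.
Implicit Types (A B : set (X * X)) (R S T : P0 X).

Lemma hausdorff_entourageS A B :
  A `<=` B -> hausdorff_entourage A `<=` hausdorff_entourage B.
Proof.
move=> AB [R S] [RS SR].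
by split=> x /= => [/RS|/SR] [y Py /AB]; exists y.
Qed.

Lemma hausdorff_entourage_refl A R :
  diagonal `<=` A -> hausdorff_entourage A (R, R).
Proof. by move=> DA; split=> x Rx; exists x => //; apply: DA. Qed.

Lemma hausdorff_entourage_sym A R S :
  hausdorff_entourage A (R, S) -> hausdorff_entourage A (S, R).
Proof. by case. Qed.

Lemma hausdorff_entourage_comp A :
  rel_comp (hausdorff_entourage A) (hausdorff_entourage A)
    `<=` hausdorff_entourage (rel_comp A A).
Proof.
move=> [R T] [S [RS SR] [ST TS]]; split=> x /=.
  by move=> /RS [y /ST [z Tz Azy] Ayx]; exists z => //; exists y.
by move=> /TS [y /SR [z Rz Azy] Ayx]; exists z => //; exists y.
Qed.

End HausdorffEntourages.

(** * Comparison of the two families of entourages *)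

Section HausdorffDistance.
Variables (disp : Order.disp_t) (I : orderType disp) (X : Type).
Variable d : X -> X -> with_infty I.
Hypothesis mI : meet_complete I.

Lemma hausdorff_distE R S : hausdorff_dist d R S =
  infimum infty (@fin _ I @`
    [set a | hausdorff_entourage (entourage d a) (R, S)]).
Proof.
rewrite /hausdorff_dist; congr (infimum infty (_ @` _)).
(* A union of balls around the points of S is the image of S. *)
have ballE (U : set X) a :
    \bigcup_(s in U) cball d s a = rel_image (entourage d a) U.
  apply/seteqP; split=> x [s Us].
    by move=> [_ -> dx]; exists s.
  by move=> dx; exists s => //; exists s.
by apply/funext => a; rewrite /mkset !ballE.
Qed.

Lemma hausdorff_dist_infimums R S :
  infimums (@fin _ I @`
    [set a | hausdorff_entourage (entourage d a) (R, S)]) (hausdorff_dist d R S).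
Proof. by rewrite hausdorff_distE; apply: infimumsP_fin. Qed.

Lemma hausdorff_entourage_sub_dist a :
  hausdorff_entourage (entourage d a) `<=` entourage (hausdorff_dist d) a.
Proof.
move=> [R S] aRS; have [lb _] := hausdorff_dist_infimums R S.
by apply: lb; exists a.
Qed.

Lemma entourage_hausdorff_dist_lt a b : (a < b)%O ->
  entourage (hausdorff_dist d) a `<=` hausdorff_entourage (entourage d b).
Proof.
move=> ab [R S] /= dRS; apply: contrapT => nbRS.
have [_ glb] := hausdorff_dist_infimums R S.
(* By totality and upward closure, b is a lower bound of the radii, so it is at
   most their infimum, which is at most a. *)
suff /glb /Order.POrderTheory.le_trans /(_ dRS) ba :
    lbound (@fin _ I @`
      [set c | hausdorff_entourage (entourage d c) (R, S)]) (fin b).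
  by move: (Order.POrderTheory.lt_le_trans ab ba); rewrite Order.POrderTheory.ltxx.
move=> _ [c cRS <-]; have [//|cb] := Order.TotalTheory.leP b c.
case: nbRS; apply: hausdorff_entourageS cRS.
exact/entourage_le/Order.POrderTheory.ltW.
Qed.

(** When [a] is the maximum of [I], a finite distance already provides some
    radius, and it is at most [a]; otherwise any strictly larger level works. *)
Lemma entourage_hausdorff_dist_sub a : exists b,
  entourage (hausdorff_dist d) a `<=` hausdorff_entourage (entourage d b).
Proof.
have [[b ab]|amax] := pselect (exists b, (a < b)%O).
  by exists b; apply: entourage_hausdorff_dist_lt.
exists a => -[R S] /= dRS; apply: contrapT => naRS.
have [_ glb] := hausdorff_dist_infimums R S.
(* Otherwise there is no radius at all and the distance is infinite. *)
suff /glb /Order.POrderTheory.le_trans /(_ dRS) :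
  lbound (@fin _ I @`
    [set c | hausdorff_entourage (entourage d c) (R, S)]) infty by [].
move=> _ [c cRS <-]; case: naRS; apply: hausdorff_entourageS cRS.
apply: entourage_le; case: (Order.TotalTheory.leP c a) => // ac.
by case: amax; exists c.
Qed.

Lemma coarse_metric_hausdorff_dist :
  coarse_metric d -> coarse_metric (hausdorff_dist d).
Proof.
move=> dm; have [dir [z z0 dz] dC [Phi dPhi]] := dm; split=> //.
- exists z => // R; apply: Order.POrderTheory.le_anti; apply/andP; split.
    apply: (@hausdorff_entourage_sub_dist z (R, R)).
    exact/hausdorff_entourage_refl/entourage_diagonal.
  have [_ glb] := hausdorff_dist_infimums R R.
  by apply: glb => _ [c _ <-]; apply: z0.
- move=> R S; rewrite !hausdorff_distE; congr (infimum infty (_ @` _)).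
  by apply/seteqP; split=> a; apply: hausdorff_entourage_sym.
have [beta betaP] := choice entourage_hausdorff_dist_sub.
exists (Phi \o beta) => a [R T] [S RS ST].
apply/hausdorff_entourage_sub_dist/(hausdorff_entourageS (dPhi _)).
apply: hausdorff_entourage_comp.
by exists S; apply: betaP.
Qed.

Lemma coarse_induced_hausdorff_dist : [set: X] !=set0 -> coarse_metric d ->
  coarse_induced (hausdorff_dist d) = hausdorff_coarse (coarse_induced d).
Proof.
move=> X0 dm; have hm := coarse_metric_hausdorff_dist dm.
have PX : P0 X setT by [].
pose XX : P0 X := exist _ setT (mem_set PX).
have P00 : [set: P0 X] !=set0 by exists XX.
have [hcs _] := (coarse_inducedP P00 hm _).2 erefl.
apply/seteqP; split=> [A hA G [Gcs HG]|].
  have [a Aa] := induced_sub_entourage P00 hm hA.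
  have [b ab] := entourage_hausdorff_dist_sub a.
  apply: (coarse_subset Gcs (A := hausdorff_entourage (entourage d b))).
  - apply: HG; exists (entourage d b) => //; split.
    + exact: entourage_in_induced.
    + exact: entourage_inverse.
    + exact: entourage_diagonal.
  - exact: subset_trans ab.
  - exact: coarse_P0 hA.
apply: smallest_sub => // _ [A [dA _ DA] <-].
have [a Aa] := induced_sub_entourage X0 dm dA.
apply: (coarse_subset hcs (entourage_in_induced a P00 hm)).
  exact: subset_trans (hausdorff_entourageS Aa) (@hausdorff_entourage_sub_dist a).
by exists (XX, XX); apply: hausdorff_entourage_refl.
Qed.

End HausdorffDistance.

Theorem proposition11 (disp : Order.disp_t) (I : orderType disp) (X : Type)
    (d : X -> X -> with_infty I) :
  [set: X] !=set0 ->
  meet_complete I ->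
  coarse_metric d ->
  coarse_metric (hausdorff_dist d) /\
  coarse_induced (hausdorff_dist d) = hausdorff_coarse (coarse_induced d).
Proof.
move=> X0 mI dm; split; first exact: coarse_metric_hausdorff_dist.
exact: coarse_induced_hausdorff_dist.
Qed.
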